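(* For every odd integer $a\ge5$, the subtraction game $\mathcal{S}(a,2a+1,3a)$ is ultimately bipartite; that is, there exists $n_0\ge0$ such that for all $n\ge n_0$, $\mathcal{G}(n)=0$ if $n-n_0$ is even and $\mathcal{G}(n)=1$ if $n-n_0$ is odd.
   Context: For a finite set $S$ of positive integers, the subtraction game $\mathcal{S}(S)$ is played on a single pile of coins: two players alternately remove $s\in S$ coins (with $s$ at most the pile size); the player making the last move wins. The nim-value (Sprague–Grundy value) of a pile of $n$ coins is $\mathcal{G}(n)=\operatorname{mex}\{\mathcal{G}(n-s): s\in S,\ s\le n\}$. A subtraction game is ultimately bipartite if its nim-sequence is ultimately periodic with period 2, eventually taking the alternating values $0,1,0,1,\ldots$. *)

(* Defs.v *)
From mathcomp Require Import all_boot.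
From mathcomp Require Import finmap.

Set Implicit Arguments.
Unset Strict Implicit.
Unset Printing Implicit Defensive.

(* At most [size A] values are excluded, so the search below always succeeds
   within [iota 0 (size A).+1]; see [mexP]. *)
Definition mex (A : seq nat) : nat :=
  find [pred k | k \notin A] (iota 0 (size A).+1).

Lemma mexP (A : seq nat) :
  mex A \notin A /\ forall k, k < mex A -> k \in A.
Proof.
have hasA : has [pred k | k \notin A] (iota 0 (size A).+1).
  apply/negPn/negP => /hasPn allA.
  have sub : {subset iota 0 (size A).+1 <= A}.
    by move=> k /allA /=; rewrite negbK.
  by have := uniq_leq_size (iota_uniq 0 _) sub; rewrite size_iota ltnn.
have lt_mex : mex A < (size A).+1.
  by move: hasA; rewrite has_find size_iota.
split.
  by have := nth_find 0 hasA; rewrite nth_iota.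
move=> k lt_k; have := before_find 0 lt_k.
by rewrite nth_iota ?(ltn_trans lt_k) //= => /negbFE.
Qed.

(* Piles reachable in one move from a pile of [n] coins. The test [0 < s]
   is vacuous when [S] is a set of positive integers. *)
Definition options (S : {fset nat}) (n : nat) : seq nat :=
  [seq n - s | s <- S & 0 < s <= n].

(* Course-of-values recursion: [nim_prefix S n] lists the nim-values of the
   piles [0, ..., n - 1]. *)
Fixpoint nim_prefix (S : {fset nat}) (n : nat) : seq nat :=
  if n is m.+1 then
    let g := nim_prefix S m in
    rcons g (mex [seq nth 0 g k | k <- options S m])
  else [::].

Definition nim_value (S : {fset nat}) (n : nat) : nat :=
  nth 0 (nim_prefix S n.+1) n.

Lemma size_nim_prefix S n : size (nim_prefix S n) = n.
Proof. by elim: n => //= n IHn; rewrite size_rcons IHn. Qed.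

Lemma nth_nim_prefix S n k : k < n -> nth 0 (nim_prefix S n) k = nim_value S k.
Proof.
elim: n => // n IHn; rewrite ltnS leq_eqVlt => /predU1P[-> // | lt_kn].
by rewrite /= nth_rcons size_nim_prefix lt_kn IHn.
Qed.

Lemma nim_valueE S n :
  nim_value S n = mex [seq nim_value S k | k <- options S n].
Proof.
rewrite {1}/nim_value /= nth_rcons size_nim_prefix ltnn eqxx.
congr mex; apply/eq_in_map => k /mapP[s]; rewrite mem_filter.
case/andP=> /andP[s_gt0 le_sn] _ ->; apply: nth_nim_prefix.
by rewrite ltn_subrL s_gt0 (leq_trans s_gt0).
Qed.

Definition ultimately_bipartite (S : {fset nat}) : Prop :=
  exists n0 : nat, forall n : nat, n0 <= n ->
    nim_value S n = if odd (n - n0) then 1 else 0.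

(* Main.v *)
Require Import Defs.
From mathcomp Require Import all_boot.
From mathcomp Require Import finmap.
From mathcomp Require Import zify.

(** Arrange the nim-values in rows of length [a], so that the pile
    [n = r * a + c] with [c < a] sits in row [r] and column [c]. A move goes up
    one row, up three rows, or up two rows and one column to the left (from
    column [0]: to the last column of row [r - 3]). Four consecutive rows
    form a block; block [0] is essentially constant along each row with values
    0, 1, 2, 3, and in block [q] the first [2q] or so columns have already
    settled to the parity of [r + c], which is the parity of [n] as [a] is odd.
    Once [2q > a] every column has settled. *)

Lemma mex_unique (A : seq nat) m :
  m \notin A -> (forall k, k < m -> k \in A) -> mex A = m.
Proof.
move=> mA ltA; have [xA ltxA] := mexP A.
case: (ltngtP (mex A) m) => // [/ltA|/ltxA]; first by rewrite (negPf xA).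
by rewrite (negPf mA).
Qed.

Lemma nim_value_unique (S : {fset nat}) n m :
    (forall s, s \in S -> 0 < s <= n -> nim_value S (n - s) != m) ->
    (forall k, k < m ->
       exists2 s, s \in S & (0 < s <= n) && (nim_value S (n - s) == k)) ->
  nim_value S n = m.
Proof.
move=> neq_m lt_m; rewrite nim_valueE; apply: mex_unique => [|k /lt_m].
  apply/mapP => -[_ /mapP[s + ->]]; rewrite mem_filter => /andP[s_n sS] m_eq.
  by have := neq_m s sS s_n; rewrite -m_eq eqxx.
case=> s sS /andP[s_n /eqP <-]; apply: map_f.
by apply: (map_f (fun s => n - s)); rewrite mem_filter s_n.
Qed.

(* The value in column [c] of row [4 * q + t], for [t < 4]. *)
Definition block_value (q t c : nat) : nat :=
  match t with
  | 0 => if c.+1 == 2 * q then 2 else if 2 * q < c.+1 then 0 else odd c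
  | 1 => if c < 2 * q then ~~ odd c else true
  | 2 => if 2 * q < c then 2 else odd c
  | _ => if 2 * q < c then 3 else ~~ odd c
  end.

Definition grid (r c : nat) : nat := block_value (r %/ 4) (r %% 4) c.

Lemma gridE q t c : grid (q * 4 + t) c = block_value (q + t %/ 4) (t %% 4) c.
Proof. by rewrite /grid divnMDl // modnMDl. Qed.

(** The strict bound puts [c] to the left of column [2 * q - 1], where row [4 * q] still holds a
    stray 2; further left the rows of block [q] alternate between [odd c] and [~~ odd c]. *)
Lemma grid_settled r c : 2 * (r %/ 4) > c.+1 -> grid r c = odd (r + c).
Proof.
have -> : odd (r + c) = odd (r %% 4 + c) by rewrite {1}(divn_eq r 4) !oddD oddM andbF.
rewrite /grid; have : r %% 4 < 4 by rewrite ltn_mod.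
move: (r %/ 4) (r %% 4) => q t.
by case: t => [|[|[|[|//]]]] _ /= lt_c; rewrite ?negbK; repeat case: ifP => //; lia.
Qed.

Definition grid_option (a r c v : nat) : bool :=
  [|| (0 < r) && (grid (r - 1) c == v),
      (2 < r) && (grid (r - 3) c == v),
      [&& 1 < r, 0 < c & grid (r - 2) c.-1 == v]
    | [&& 2 < r, c == 0 & grid (r - 3) a.-1 == v]].

(** The width [a] enters only through the wrap-around option. It reads column [a.-1], which is even,
    so it never meets the stray 2 in the odd column [2 * q - 1] of row [4 * q]. *)
Lemma grid_optionP a r c : odd a ->
  ~~ grid_option a r c (grid r c) /\
  forall k, k < grid r c -> grid_option a r c k.
Proof.
move=> odd_a; have odda1 : odd a.-1 = false by lia.
rewrite /grid_option; case: r => [|[|[|r]]].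
- by rewrite /grid div0n mod0n.
- by rewrite /grid !divn_small //= ; split=> // -[].
- by rewrite /grid !divn_small //=; case: c => [|c]; split=> // -[|[]].
(* From row 3 on, every move stays on the board. With the row written as [q * 4 + t + 3], each [t]
   leaves a finite check on the parity of [c] and its position relative to [2 * q]. *)
rewrite !subSS !subn0 (divn_eq r 4); have : r %% 4 < 4 by rewrite ltn_mod.
move: (r %/ 4) (r %% 4) => q t; rewrite -!addnS !gridE.
case: t => [|[|[|[|//]]]] _; rewrite !addnS ?addn0 ?addn1 /= odda1.
all: case: c => [|c] /=; split=> [|[|[|[|k]]]] /=.
all: try case odd_c: (odd c) => /=.
all: rewrite ?andbT ?andbF ?orbF //.
all: by repeat (case: ifP => /=); lia.
Qed.

Lemma nim_value_grid a n : odd a ->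
  nim_value [fset a; (2 * a + 1)%N; (3 * a)%N]%fset n = grid (n %/ a) (n %% a).
Proof.
move=> odd_a; have a_gt0 : 0 < a by exact: odd_gt0.
set S := [fset _; _; _]%fset.
have inS s : (s \in S) = [|| s == a, s == 2 * a + 1 | s == 3 * a].
  by rewrite !inE orbA.
have [m] := ubnP n; elim: m n => // m IHm n; rewrite ltnS => n_m.
set r := n %/ a; set c := n %% a.
have c_lt : c < a by rewrite ltn_mod.
have n_eq : n = r * a + c by exact: divn_eq.
have IH s r' c' : 0 < s -> c' < a -> r' * a + c' + s = n ->
    s <= n /\ nim_value S (n - s) = grid r' c'.
  move=> s_gt0 c'_lt def_n; split; first by lia.
  have -> : n - s = r' * a + c' by lia.
  by rewrite IHm ?divnMDl // ?modnMDl ?divn_small ?modn_small ?addn0 //; lia.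
(* Splitting off the rows crossed by a move makes the goals linear in the products, as [lia]
   requires. *)
have row i : i <= r -> r * a = (r - i) * a + i * a.
  by move=> le_ir; rewrite -mulnDl subnK.
have opt_a : 0 < r -> a <= n /\ nim_value S (n - a) = grid (r - 1) c.
  by move=> r_gt0; apply: IH => //; rewrite n_eq (row 1) //; lia.
have opt_3a : 2 < r -> 3 * a <= n /\ nim_value S (n - 3 * a) = grid (r - 3) c.
  by move=> r_gt2; apply: IH; rewrite ?n_eq ?(row 3) //; lia.
have opt_diag : 1 < r -> 0 < c ->
    2 * a + 1 <= n /\ nim_value S (n - (2 * a + 1)) = grid (r - 2) c.-1.
  by move=> r_gt1 c_gt0; apply: IH; rewrite ?n_eq ?(row 2) //; lia.
have opt_wrap : 2 < r -> c = 0 ->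
    2 * a + 1 <= n /\ nim_value S (n - (2 * a + 1)) = grid (r - 3) a.-1.
  by move=> r_gt2 c0; apply: IH; rewrite ?n_eq ?(row 3) //; lia.
have [no_opt all_opt] := grid_optionP a r c odd_a.
apply: nim_value_unique => [s|k /all_opt].
  rewrite inS => s_cases /andP[_ s_n]; apply: contraNneq no_opt => <-.
  rewrite /grid_option; case/or3P: s_cases s_n => /eqP-> le_n.
  - have r_gt0 : 0 < r by rewrite divn_gt0.
    by have [_ ->] := opt_a r_gt0; rewrite r_gt0 eqxx.
  - have r_gt1 : 1 < r by rewrite leq_divRL //; lia.
    case: (posnP c) => [c0|c_gt0].
      (* In column 0 the pile is [r * a], and [2 * a + 1 <= r * a] excludes [r = 2]. *)
      have r_gt2 : 2 < r by rewrite ltnNge; apply/negP => le_r2; nia.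
      by have [_ ->] := opt_wrap r_gt2 c0; rewrite r_gt2 !eqxx !orbT.
    by have [_ ->] := opt_diag r_gt1 c_gt0; rewrite r_gt1 eqxx !orbT.
  have r_gt2 : 2 < r by rewrite leq_divRL.
  by have [_ ->] := opt_3a r_gt2; rewrite r_gt2 eqxx !orbT.
case/or4P=> [/andP[/opt_a] | /andP[/opt_3a] | /and3P[r_gt1 /(opt_diag r_gt1)]
           | /and3P[r_gt2 /eqP /(opt_wrap r_gt2)]] [le_n val] grid_k;
  [exists a | exists (3 * a) | exists (2 * a + 1) | exists (2 * a + 1)];
  rewrite ?inS ?eqxx ?orbT // val grid_k le_n; lia.
Qed.

Theorem theorem7p1 (a : nat) (odd_a : odd a) (a_ge5 : 5 <= a) :
  ultimately_bipartite [fset a; (2 * a + 1)%N; (3 * a)%N]%fset.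
Proof.
(* From row [4 * a] on, the block index [q] is at least [a], so [2 * q >= 2 * a > c.+1] for every
   column [c < a]. This bound is generous; being even, it does not shift the parity of [n]. *)
exists (4 * a * a) => n le_n; rewrite nim_value_grid //.
have c_lt : n %% a < a by rewrite ltn_mod odd_gt0.
have le_q : a <= n %/ a %/ 4 by rewrite -divnMA leq_divRL; lia.
rewrite grid_settled; last by lia.
have odd_n : odd n = odd (n %/ a + n %% a).
  by rewrite {1}(divn_eq n a) !oddD oddM odd_a andbT.
by rewrite -odd_n oddB // !oddM addbF; case: odd.
Qed.
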